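(* For any LSBM $X_t=\tilde W_{T_t}$ (Brownian motion with drift $\beta$ time changed by an independent Lévy subordinator $T$) and any $x_0>0$, the sequence of stopping times $(t_i^*(x_0))_{i\ge1}$ converges almost surely to the first passage time $t^*=\inf\{t\ge0: X_t\le0\}$.
   Context: Setup (LSBM): $W$ standard Brownian motion, $\beta\in\mathbb{R}$, $\tilde W_S=x_0+W_S+\beta S$; $T$ a subordinator (nondecreasing Lévy process with drift $b\ge0$ and Lévy measure on $(0,\infty)$) independent of $W$; $X_t=\tilde W_{T_t}$. For $x\in\mathbb{R}$, $T^*(x)=\inf\{S\ge0:x+W_S+\beta S\le0\}$. $t_1^*(x_0)=\inf\{t\ge0:T_t\ge T^*(x_0)\}$. For $i\ge2$: if $t_{i-1}^*=\infty$ or $X_{t_{i-1}^*}\le0$ set $t_i^*=t_{i-1}^*$; otherwise $t_i^*=\inf\{t\ge t_{i-1}^*:T_t-T_{t_{i-1}^*}\ge\sigma_{i-1}\}$ with $\sigma_{i-1}=\inf\{S\ge0:\tilde W_{T_{t_{i-1}^*}+S}\le0\}$. All infima of empty sets are $+\infty$. *)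

(* Defs.v *)
From HB Require Import structures.
From mathcomp Require Import all_boot all_order all_algebra.
From mathcomp Require Import all_classical all_reals all_analysis.
Set Implicit Arguments. Unset Strict Implicit. Unset Printing Implicit Defensive.
Import Order.TTheory GRing.Theory Num.Theory.
Import numFieldNormedType.Exports.
Local Open Scope classical_set_scope.
Local Open Scope ring_scope.

Section Defs.
Context {R : realType} {d : measure_display} {Omega : measurableType d}.
Variable P : probability Omega R.

Definition sigma_of (I : Type) (X : I -> Omega -> R) (J : set I) : set (set Omega) :=
  <<s \bigcup_(i in J) preimage_set_system setT (X i) (measurable : set (set R)) >>.

Definition sigma_rv (X : Omega -> R) : set (set Omega) :=
  <<s preimage_set_system setT X (measurable : set (set R)) >>.

Definition indep_sys (F G : set (set Omega)) : Prop :=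
  forall A B, F A -> G B -> P (A `&` B) = (P A * P B)%E.

Definition nonneg_times : set R := [set t | 0 <= t].

Definition is_brownian_motion (W : R -> Omega -> R) : Prop :=
  [/\ (forall s, measurable_fun setT (W s)),
      {ae P, forall w, W 0 w = 0 /\
          {within nonneg_times, continuous (fun s => W s w)}} &
      (forall s t, 0 <= s -> s < t ->
         indep_sys (sigma_rv (fun w => W t w - W s w)) (sigma_of W `[0, s]%classic)
         /\ forall A, measurable A ->
              P ((fun w => W t w - W s w) @^-1` A) = normal_prob 0 (Num.sqrt (t - s)) A)].

Definition is_subordinator (T : R -> Omega -> R) : Prop :=
  [/\ (forall t, measurable_fun setT (T t)),
      {ae P, forall w, [/\ T 0 w = 0,
          (forall s t, 0 <= s -> s <= t -> T s w <= T t w) &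
          (forall t, 0 <= t -> (fun u => T u w) @ t^'+ --> T t w)]} &
      (forall s h, 0 <= s -> 0 <= h ->
         indep_sys (sigma_rv (fun w => T (s + h) w - T s w)) (sigma_of T `[0, s]%classic)
         /\ forall A, measurable A ->
              P ((fun w => T (s + h) w - T s w) @^-1` A) = P (T h @^-1` A))].

End Defs.

(** Pathwise definitions: w is a path of W, tau a path of T. *)
Section Pathwise.
Context {R : realType}.
Variables (x0 beta : R) (w tau : R -> R).
Local Open Scope ereal_scope.

Definition Wtilde (S : R) : R := (x0 + w S + beta * S)%R.

Definition Xproc (t : R) : R := Wtilde (tau t).

(** T^*(x) = inf{S >= 0 : x + W_S + beta S <= 0} (inf set0 = +oo) *)
Definition Tstar (x : R) : \bar R :=
  ereal_inf [set S%:E | S in [set S : R | (0 <= S)%R /\ (x + w S + beta * S <= 0)%R]].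

Definition tstar1 : \bar R :=
  ereal_inf [set t%:E | t in [set t : R | (0 <= t)%R /\ Tstar x0 <= (tau t)%:E]].

Definition tstar_step (prev : \bar R) : \bar R :=
  match prev with
  | EFin r =>
      if (Xproc r <= 0)%R then prev else
      let sigma := ereal_inf [set S%:E | S in
            [set S : R | (0 <= S)%R /\ (Wtilde (tau r + S) <= 0)%R]] in
      ereal_inf [set t%:E | t in [set t : R | (r <= t)%R /\ sigma <= (tau t - tau r)%:E]]
  | _ => prev
  end.

(** tstar_from1 n = t_{n+1}^* *)
Fixpoint tstar_from1 (n : nat) : \bar R :=
  match n with
  | O => tstar1
  | S m => tstar_step (tstar_from1 m)
  end.

Definition tstar (i : nat) : \bar R := tstar_from1 i.-1.

Definition first_passage : \bar R :=
  ereal_inf [set t%:E | t in [set t : R | (0 <= t)%R /\ (Xproc t <= 0)%R]].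

End Pathwise.

(* Main.v *)
Require Import Defs.
From HB Require Import structures.
From mathcomp Require Import all_boot all_order all_algebra.
From mathcomp Require Import all_classical all_reals all_analysis.
From mathcomp Require Import measurable_realfun lra.
Import Order.TTheory GRing.Theory Num.Theory.
Import numFieldNormedType.Exports.
Local Open Scope classical_set_scope.
Local Open Scope ring_scope.

(** Along a fixed path, the times t_i^* increase and are bounded by t^*.  If they
    stay strictly before t^* and have a finite limit s, then between T_{t_i^*} and
    T_{t_{i+1}^*} the path of W~ hits (-oo, 0], while it is positive at T_{t_i^*};
    by continuity W~ vanishes at T_{s-}.  Hence X_s = 0 unless T jumps at s, and it
    remains to exclude that W~ vanishes at the left limit of a jump of T.  Every
    jump interval contains a rational q, and T_{s-} is then the supremum of the values
    of T below q, a random time L independent of W.  Rounding L down to a grid and using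
    independence, the probability that |W~| <= e at the rounded time, for L > dl, is
    at most 2 e times the peak of the centered Gaussian density of variance dl; so
    W~_L <> 0 almost surely on {L > 0}. *)

(** * Local continuity estimates for paths *)

Lemma within_nonneg_continuous_ball {R : realType} (f : R -> R) :
  {within nonneg_times, continuous f} ->
  forall y e, 0 <= y -> 0 < e -> exists2 dl, 0 < dl &
    forall z, 0 <= z -> `|z - y| < dl -> `|f z - f y| < e.
Proof.
move=> cf y e y0 e0; have := cf y.
rewrite /continuous_at/= => cfy.
have {cfy} : f z @[z --> within nonneg_times (nbhs y)] --> f y.
  by rewrite nbhs_subspace_in.
move=> /cvgrPdist_lt /(_ e e0).
rewrite near_withinE => -[dl /= dl0 H]; exists dl => // z z0 zy.
by rewrite distrC; apply: (H z) => //=; rewrite distrC.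
Qed.

Lemma at_right_cvg_lt {R : realType} {f : R -> R} {t a : R} :
  f u @[u --> t^'+] --> f t -> f t < a ->
  exists2 dl, 0 < dl & forall u, t <= u -> u < t + dl -> f u < a.
Proof.
move=> cf fta; have e0 : 0 < a - f t by rewrite subr_gt0.
move/cvgrPdist_lt : cf => /(_ _ e0).
rewrite /at_right near_withinE => -[dl /= dl0 H]; exists dl => // u.
rewrite le_eqVlt => /predU1P[<-//|tu] utd.
have /= Hu := H u; suff : `|f t - f u| < a - f t by rewrite ltr_norml; lra.
by apply: Hu => //; rewrite ltr_norml; lra.
Qed.

Lemma Wtilde_ball {R : realType} (x0 beta : R) {w : R -> R} :
  {within nonneg_times, continuous w} ->
  forall y e, 0 <= y -> 0 < e -> exists2 dl, 0 < dl &
    forall z, 0 <= z -> `|z - y| < dl ->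
      `|Wtilde x0 beta w z - Wtilde x0 beta w y| < e.
Proof.
move=> w_cont; apply: within_nonneg_continuous_ball => z.
apply: cvgD; first by apply: cvgD; [exact: cvg_cst|exact: w_cont].
apply: cvgM; first exact: cvg_cst.
by apply: (continuous_subspaceT (f := id)) => ?; exact: cvg_id.
Qed.

(* If [q] lies strictly inside a jump of [tau] at time [s], this is the left limit
   [tau (s-)]; only rational times are used, to keep it measurable.  It is 0 when
   the set is empty. *)
Definition left_sup {R : realType} (tau : R -> R) (q : R) : R :=
  sup [set tau (ratr r) | r in [set r : rat | 0 <= r /\ tau (ratr r) < q]].

(** * Pathwise convergence of the iterated times *)

Section Paths.
Context {R : realType}.
Variables (x0 beta : R) (w tau : R -> R).
Hypothesis x0_gt0 : 0 < x0.
Hypothesis w0 : w 0 = 0.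
Hypothesis w_cont : {within nonneg_times, continuous w}.
Hypothesis tau0 : tau 0 = 0.
Hypothesis tau_mono : forall s t, 0 <= s -> s <= t -> tau s <= tau t.
Hypothesis tau_rc : forall t, 0 <= t -> tau u @[u --> t^'+] --> tau t.
(** The one path property that rests on independence: no zero of [Wtilde] at the bottom of a jump of
    [tau]. *)
Hypothesis jump_nonzero : forall q : rat,
  0 < left_sup tau (ratr q) -> Wtilde x0 beta w (left_sup tau (ratr q)) != 0.

Let Wt := Wtilde x0 beta w.
Let X := Xproc x0 beta w tau.
Let step := tstar_step x0 beta w tau.

Let tau_ge0 t : 0 <= t -> 0 <= tau t.
Proof. by move=> t0; rewrite -tau0 tau_mono. Qed.

Let Wt_ball y e : 0 <= y -> 0 < e -> exists2 dl, 0 < dl &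
  forall z, 0 <= z -> `|z - y| < dl -> `|Wt z - Wt y| < e.
Proof. exact: Wtilde_ball. Qed.

(** By continuity a finite infimum is attained, and positivity at [s] pushes the hitting point
    strictly past [s]. *)
Lemma ereal_inf_hitting s : 0 <= s -> 0 < Wt s ->
  let sigma := ereal_inf [set S%:E | S in [set S : R | 0 <= S /\ Wt (s + S) <= 0]] in
  sigma = +oo%E \/ exists z, [/\ s < z, Wt z <= 0 & sigma = (z - s)%:E].
Proof.
move=> s0 Ws sigma; have sg0 : (0 <= sigma)%E.
  by apply: le_ereal_inf_tmp => _ [S [S0 _] <-]; rewrite lee_fin.
case E : sigma => [z| |]; [right|by left|by rewrite E in sg0].
rewrite E lee_fin in sg0; have [Wz|Wz] := leP (Wt (s + z)) 0.
  exists (s + z); split=> //; last by rewrite addrC addKr.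
  rewrite ltrDl lt_neqAle sg0 andbT; apply/negP => /eqP z0.
  by move: Wz; rewrite -z0 addr0 leNgt Ws.
have [|dl dl0 H] := Wt_ball (s + z) (Wt (s + z)) _ Wz; first exact: addr_ge0.
have /ereal_inf_lt[_ [S [S0 WS] <-]] : (sigma < (z + dl)%:E)%E.
  by rewrite E lte_fin; lra.
rewrite lte_fin => Szd.
have : (sigma <= S%:E)%E by apply: ereal_inf_lbound; exists S.
rewrite E lee_fin => zS.
have := H (s + S); rewrite !ltr_norml => /(_ (addr_ge0 s0 S0)) WSz.
suff : - Wt (s + z) < Wt (s + S) - Wt (s + z) < Wt (s + z) by lra.
by apply: WSz; lra.
Qed.

(** Finiteness rules out an infinite hitting time. Right-continuity of [tau] then makes the outer
    infimum attained, so [tau t] has reached the hitting point, which lies strictly above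
    [tau r]. *)
Lemma step_fin r t : 0 <= r -> 0 < X r -> step r%:E = t%:E ->
  r < t /\ exists2 z, tau r < z <= tau t & Wt z <= 0.
Proof.
move=> r0 Xr; rewrite /step/= leNgt Xr/=.
have [->|[z [rz Wz ->]]] := ereal_inf_hitting _ (tau_ge0 _ r0) Xr.
  rewrite (_ : [set _ | _ in _] = set0) ?ereal_inf0// -subset0.
  by move=> y [u [_ +] _]; rewrite leye_eq.
set A := [set _ | _ in _] => At.
have rt : r <= t.
  rewrite -lee_fin -At; apply: le_ereal_inf_tmp => _ [u [ru _] <-].
  by rewrite lee_fin.
have zt : z <= tau t.
  rewrite leNgt; apply/negP => tz.
  have [dl dl0 H] := at_right_cvg_lt (tau_rc _ (le_trans r0 rt)) tz.
  have /ereal_inf_lt[_ [u [ru uz] <-]] : (ereal_inf A < (t + dl)%:E)%E.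
    by rewrite At lte_fin; lra.
  rewrite lte_fin => utd.
  have : (ereal_inf A <= u%:E)%E by apply: ereal_inf_lbound; exists u.
  rewrite At lee_fin => tu; move: uz (H u tu utd); rewrite lee_fin; lra.
split; last by exists z => //; rewrite rz zt.
rewrite lt_neqAle rt andbT; apply/eqP => rE.
by move: zt; rewrite -rE leNgt rz.
Qed.

Lemma step_ge t : (t <= step t)%E.
Proof.
case: t => [r| |]//=; rewrite /step/=; case: ifP => // _.
by apply: le_ereal_inf_tmp => _ [u [ru _] <-]; rewrite lee_fin.
Qed.

(** The time [t] is itself a competitor in the infimum: [tau t - tau r] is one of the values over
    which the inner hitting time is minimised. *)
Lemma step_le s t : (0 <= s)%E -> 0 <= t -> X t <= 0 -> (s <= t%:E)%E ->
  (step s <= t%:E)%E.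
Proof.
move=> s0 t0 Xt; case: s s0 => [r| |]//=; rewrite !lee_fin => r0 rt.
rewrite /step/=; case: ifP => [_|Xr]; first by rewrite lee_fin.
apply: ereal_inf_lbound; exists t => //; split => //.
apply: ereal_inf_lbound; exists (tau t - tau r) => //; split.
  by rewrite subr_ge0 tau_mono.
by rewrite addrC subrK.
Qed.

(** As [tau 0 = 0] and the path starts at [x0 > 0], the first time is an ordinary step from time 0,
    so a single map is iterated. *)
Lemma tstar_iter i : tstar x0 beta w tau i.+1 = iter i.+1 step 0%:E.
Proof.
rewrite /tstar/=; elim: i => [|i IH]; last by rewrite /= IH.
have WE S : Wtilde x0 beta w (tau 0 + S) = x0 + w S + beta * S.
  by rewrite /Wtilde tau0 add0r.
rewrite /= /step/= /Xproc /Wtilde tau0 w0 mulr0 !addr0 leNgt x0_gt0/=.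
rewrite /tstar1; congr (ereal_inf (image _ _)); apply/funext => t/=.
rewrite subr0 /Tstar; congr (_ /\ (ereal_inf _ <= _)%E).
by congr image; apply/funext => S/=; rewrite add0r.
Qed.

Lemma iter_step_ge0 n : (0 <= iter n step 0%:E)%E.
Proof. by elim: n => [|n IH] //; rewrite iterS (le_trans IH)// step_ge. Qed.

Lemma iter_step_le t n : 0 <= t -> X t <= 0 -> (iter n step 0%:E <= t%:E)%E.
Proof.
move=> t0 Xt; elim: n => [|n IH]; first by rewrite lee_fin.
by rewrite iterS step_le// iter_step_ge0.
Qed.

Lemma first_passage_le t : 0 <= t -> X t <= 0 ->
  (first_passage x0 beta w tau <= t%:E)%E.
Proof. by move=> t0 Xt; apply: ereal_inf_lbound; exists t. Qed.

Lemma tstar_cvg :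
  (fun i => tstar x0 beta w tau i.+1) @ \oo --> first_passage x0 beta w tau.
Proof.
set u := fun i => _.
have uE n : u n = iter n.+1 step 0%:E by rewrite /u tstar_iter.
(* The sequence is nondecreasing, hence tends to its supremum. *)
suff -> : first_passage x0 beta w tau = ereal_sup (range u).
  apply: ereal_nondecreasing_cvgn; apply/nondecreasing_seqP => n.
  by rewrite !uE [in leRHS]iterS; exact: step_ge.
apply/eqP; rewrite eq_le; apply/andP; split; last first.
  apply: ge_ereal_sup => _ [n _ <-]; apply: le_ereal_inf_tmp => _ [t [t0 Xt] <-].
  by rewrite uE iter_step_le.
have u_le n : (u n <= ereal_sup (range u))%E by apply: ereal_sup_ubound; exists n.
have u_ge0 n : (0 <= u n)%E by rewrite uE iter_step_ge0.
case E : (ereal_sup (range u)) => [s| |]; [|exact: leey|]; last first.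
  by have := le_trans (u_ge0 0%N) (u_le 0%N); rewrite E.
have /choice[v uv] : forall n, exists r, u n = r%:E.
  move=> n; have := u_ge0 n; have := u_le n; rewrite E.
  by case: (u n) => [r| |]//; exists r.
have v0 n : 0 <= v n by rewrite -lee_fin -uv.
have vs n : v n <= s by rewrite -lee_fin -uv -E.
have [[n Xn]|/forallNP Xv] := pselect (exists n, X (v n) <= 0).
  by rewrite (le_trans (first_passage_le (v n) _ _))// lee_fin.
have {}Xv n : 0 < X (v n) by rewrite ltNge; apply/negP/Xv.
have stepv n : step (v n)%:E = (v n.+1)%:E by rewrite -!uv !uE -iterS.
have vz n := step_fin (v n) (v n.+1) (v0 n) (Xv n) (stepv n).
have v_adh e : 0 < e -> exists n, s - e < v n.
  move=> e0; have /ereal_sup_gt[_ [n _ <-]] : ((s - e)%:E < ereal_sup (range u))%E.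
    by rewrite E lte_fin; lra.
  by rewrite uv lte_fin; exists n.
have vlt n : v n < s by apply: lt_le_trans (vs n.+1); case: (vz n).
have s0 : 0 <= s by exact: le_trans (vs 0%N).
(* This is the left limit of [tau] at [s], because [v] increases strictly to [s]. *)
pose L := sup (range (tau \o v)).
have tvs n : tau (v n) <= tau s by exact: tau_mono.
have supL : has_sup (range (tau \o v)).
  split; first by exists (tau (v 0%N)); exists 0%N.
  by exists (tau s) => _ [n _ <-]; exact: tvs.
have tvL n : tau (v n) <= L by apply: (ub_le_sup supL.2); exists n.
have LTs : L <= tau s by apply: ge_sup => [|_ [n _ <-]]; [exact: supL.1|exact: tvs].
have L_adh e : 0 < e -> exists n, L - e < tau (v n).
  by move=> e0; have [_ [n _ <-] ?] := sup_adherent e0 supL; exists n.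
have L0 : 0 < L.
  have [_ [z /andP[tz zt] _]] := vz 0%N.
  by rewrite (le_lt_trans (tau_ge0 _ (v0 0%N)))// (lt_le_trans tz)// (le_trans zt).
(* The hitting points, where [Wt] is at most 0, and the points [tau (v n)], where it is positive,
   both approach [L]; so neither strict sign is possible. *)
have WL : Wt L = 0.
  have [WL|WL|//] := ltrgt0P (Wt L).
    have [dl dl0 H] := Wt_ball _ _ (ltW L0) WL.
    have [n Ln] := L_adh _ dl0.
    have [_ [z /andP[tz zt] Wz]] := vz n.
    have zL := le_trans zt (tvL n.+1).
    have := H z (le_trans (tau_ge0 _ (v0 n)) (ltW tz)); rewrite !ltr_norml.
    suff : - dl < z - L < dl by move=> -> /(_ isT); lra.
    by lra.
  have WL' : 0 < - Wt L by lra.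
  have [dl dl0 H] := Wt_ball _ _ (ltW L0) WL'.
  have [n Ln] := L_adh _ dl0.
  have := H (tau (v n)) (tau_ge0 _ (v0 n)); rewrite !ltr_norml.
  have := tvL n; have : 0 < Wt (tau (v n)) := Xv n.
  move=> Wv tL; suff : - dl < tau (v n) - L < dl by move=> -> /(_ isT); lra.
  by lra.
(* Without a jump at [s], [X s = 0]. Otherwise a rational inside the jump recovers [L] as a
   [left_sup]. *)
have [Ls|Ls] := eqVneq L (tau s).
  by apply: first_passage_le => //; rewrite /X /Xproc -Ls -/Wt WL.
have {}Ls : L < tau s by rewrite lt_neqAle Ls.
have [q] := rat_in_itvoo Ls; rewrite in_itv/= => /andP[Lq qs].
suff qL : left_sup tau (ratr q) = L.
  by have := jump_nonzero q; rewrite qL -/Wt WL eqxx => /(_ L0).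
apply/eqP; rewrite eq_le; apply/andP; split.
  apply: ge_sup.
    exists (tau 0); exists 0; last by rewrite rmorph0.
    by split=> //; rewrite rmorph0 tau0 (lt_trans L0 Lq).
  move=> _ [r [r0 rq] <-].
  (* A rational before [s] precedes some [v n]; from [s] on, [tau] already exceeds [q]. *)
  have [rs|sr] := ltP (ratr r) s.
    have := rs; rewrite -subr_gt0 => /v_adh[n]; rewrite subKr => rv.
    by rewrite (le_trans _ (tvL n))// tau_mono ?ler0q// ltW.
  by have := tau_mono _ _ s0 sr; rewrite leNgt (lt_trans rq qs).
apply: ge_sup => [|_ [n _ <-]]; first exact: supL.1.
have [r] := rat_in_itvoo (vz n).1; rewrite in_itv/= => /andP[vr rv].
have r0 : 0 <= ratr r :> R by rewrite (le_trans (v0 n))// ltW.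
apply: (@le_trans _ _ (tau (ratr r))); first by rewrite /= tau_mono// ltW.
apply: ub_le_sup; first by exists (ratr q) => _ [? [_ /ltW ?] <-].
exists r => //; split; first by rewrite -(@ler0q R).
by rewrite (le_lt_trans _ Lq)// (le_trans _ (tvL n.+1))// tau_mono// ltW.
Qed.

End Paths.

(** * Measurability and Gaussian bounds *)

Lemma sigma_of_measurable {R : realType} {d} {Omega : measurableType d} (I : Type)
  (X : I -> Omega -> R) (J : set I) :
  (forall i, measurable_fun setT (X i)) -> sigma_of X J `<=` measurable.
Proof.
move=> mX; apply: smallest_sub; first exact: sigma_algebra_measurable.
by move=> _ [i _ [B mB <-]]; exact: mX.
Qed.

Lemma normal_prob_itv_le {R : realType} (s a b : R) : s != 0 -> a <= b ->
  (normal_prob 0 s `[a, b]%classic <= (normal_peak s * (b - a))%:E)%E.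
Proof.
move=> s0 ab; rewrite /normal_prob.
apply: (@le_trans _ _
  (\int[lebesgue_measure]_(x in `[a, b]) (cst (normal_peak s)%:E x))%E).
  apply: ge0_le_integral => //=.
  - by move=> x _; rewrite lee_fin normal_pdf_ge0.
  - by apply/measurable_EFinP; apply: measurable_funTS; exact: measurable_normal_pdf.
  - by move=> x _; rewrite lee_fin normal_pdf_ub.
rewrite integral_cst//= lebesgue_measure_itv/= lte_fin.
case: ltP => [_|ba]; first by rewrite -EFinB -EFinM.
by rewrite mule0 lee_fin mulr_ge0 ?normal_peak_ge0// subr_ge0.
Qed.

(** Makes the density bound uniform over all times past a fixed positive one. *)
Lemma normal_peak_sqrt_le {R : realType} (s t : R) : 0 < s -> s <= t ->
  normal_peak (Num.sqrt t) <= normal_peak (Num.sqrt s).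
Proof.
move=> s0 st; have t0 := lt_le_trans s0 st.
rewrite /normal_peak !sqr_sqrtr ?(ltW s0) ?(ltW t0)//.
rewrite lef_pV2 ?posrE ?sqrtr_gt0 ?pmulrn_lgt0 ?mulr_gt0 ?pi_gt0//.
by rewrite ler_sqrt ?lerMn2r ?ler_pM2r ?pi_gt0// mulrn_wge0// mulr_ge0 ?pi_ge0// ltW.
Qed.

(** * Brownian motion at an independent random time *)

Section IndependentTime.
Context {R : realType} {d : measure_display} {Omega : measurableType d}.
Variables (P : probability Omega R) (W : R -> Omega -> R) (x0 beta : R).
Hypothesis bmW : is_brownian_motion P W.

Let Wt (w : Omega) := Wtilde x0 beta (W^~ w).

Definition near_zero (e s : R) : set Omega := [set w | `|Wt w s| <= e].

Lemma near_zeroE e s :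
  near_zero e s = W s @^-1` `[- (x0 + beta * s) - e, - (x0 + beta * s) + e]%classic.
Proof.
apply/seteqP; split => w; rewrite /near_zero /Wt /Wtilde/= in_itv/= ler_norml.
  by move=> /andP[? ?]; apply/andP; split; lra.
by move=> /andP[? ?]; apply/andP; split; lra.
Qed.

Lemma measurable_near_zero e s : measurable (near_zero e s).
Proof.
by have [mW _ _] := bmW; rewrite near_zeroE -[X in measurable X]setTI; exact: mW.
Qed.

Lemma sigma_of_near_zero e s : 0 <= s -> sigma_of W nonneg_times (near_zero e s).
Proof.
move=> s0; apply: sub_sigma_algebra; exists s => //.
exists `[- (x0 + beta * s) - e, - (x0 + beta * s) + e]%classic.
  exact: measurable_itv.
by rewrite setTI near_zeroE.
Qed.

Lemma near_zero_le dl e s : 0 < dl -> dl <= s -> 0 <= e ->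
  (P (near_zero e s) <= (normal_peak (Num.sqrt dl) * (e + e))%:E)%E.
Proof.
move=> dl0 ds e0; have s0 := lt_le_trans dl0 ds.
have [mW W0 incr] := bmW.
have [_ /(_ _ (measurable_itv _)) incrW] := incr 0 s (lexx 0) s0.
(* The Gaussian law is that of [W s - W 0], and [W 0] vanishes only almost surely; the null set [N]
   absorbs the difference. *)
have [N [mN PN0 W0N]] : P.-negligible [set w | W 0 w != 0].
  by apply: negligibleS W0 => w /= /eqP W0w [].
pose I := `[- (x0 + beta * s) - e, - (x0 + beta * s) + e] : interval R.
have mD : measurable ((fun w => W s w - W 0 w) @^-1` [set` I]).
  rewrite -[X in measurable X]setTI; apply: measurable_funB; [exact: mW|exact: mW|by []|].
  exact: measurable_itv.
apply: (@le_trans _ _ (P ((fun w => W s w - W 0 w) @^-1` [set` I] `|` N))).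
  rewrite le_measure ?inE//; [exact: measurable_near_zero|exact: measurableU|].
  rewrite near_zeroE => w/= Iw.
  have [W0w|W0w] := eqVneq (W 0 w) 0; last by right; exact: W0N.
  by left; rewrite /= W0w subr0.
rewrite measureU0// [leLHS](incrW I) subr0.
apply: le_trans (normal_prob_itv_le _ _ _ _ _) _.
- by rewrite sqrtr_eq0 -ltNge.
- lra.
- rewrite lee_fin; apply: ler_pM; rewrite ?normal_peak_ge0//; try lra.
  exact: normal_peak_sqrt_le.
Qed.

Variables (G : set (set Omega)) (L : Omega -> R).
Hypothesis indepWG : indep_sys P (sigma_of W nonneg_times) G.
Hypothesis G_measurable : G `<=` measurable.
Hypothesis L_ivl : forall a b, 0 <= a -> a <= b -> G [set w | a < L w <= b].

(** The cells, open on the left and closed on the right, partition the half-line above [dl]; [L] is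
    rounded down to the left end of its cell. *)
Let grid (dl : R) (n k : nat) : R := dl + k%:R * n.+1%:R^-1.
Let cell dl n k : set Omega := [set w | grid dl n k < L w <= grid dl n k.+1].
Let close e dl n : set Omega :=
  \bigcup_k (near_zero e (grid dl n k) `&` cell dl n k).

Let grid_ge dl n k : dl <= grid dl n k.
Proof. by rewrite /grid lerDl mulr_ge0// invr_ge0 ler0n. Qed.

Let grid_le dl n j k : (j <= k)%N -> grid dl n j <= grid dl n k.
Proof. by move=> jk; rewrite /grid lerD2l ler_wpM2r ?invr_ge0 ?ler0n// ler_nat. Qed.

Let G_cell dl n k : 0 < dl -> G (cell dl n k).
Proof.
move=> dl0; apply: L_ivl; last exact: grid_le.
exact: le_trans (ltW dl0) (grid_ge _ _ _).
Qed.

Let measurable_cell dl n k : 0 < dl -> measurable (cell dl n k).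
Proof. by move=> dl0; apply: G_measurable; exact: G_cell. Qed.

Let trivIset_cell dl n : trivIset setT (cell dl n).
Proof.
suff H j k : (j < k)%N -> cell dl n j `&` cell dl n k = set0.
  apply/trivIsetP => j k _ _; rewrite neq_lt => /orP[|] /H //.
  by rewrite setIC.
move=> jk; rewrite -subset0 => w [/andP[_ Lj] /andP[kL _]].
by have := le_lt_trans (grid_le dl n _ _ jk) kL; rewrite ltNge Lj.
Qed.

Let measurable_close e dl n : 0 < dl -> measurable (close e dl n).
Proof.
move=> dl0; apply: bigcupT_measurable => k.
by apply: measurableI; [exact: measurable_near_zero|exact: measurable_cell].
Qed.

(** On each cell independence factors the probability. The Brownian factor is bounded uniformly, and
    the disjoint cells have total mass at most 1. *)
Let close_le e dl n : 0 < dl -> 0 <= e ->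
  (P (close e dl n) <= (normal_peak (Num.sqrt dl) * (e + e))%:E)%E.
Proof.
move=> dl0 e0; set c := _ * _.
have c0 : 0 <= c by rewrite mulr_ge0 ?normal_peak_ge0// addr_ge0.
apply: le_trans.
  apply: (measure_sigma_subadditive P
    (F := fun k => near_zero e (grid dl n k) `&` cell dl n k) _
    (measurable_close e dl n dl0)) => // k.
  by apply: measurableI; [exact: measurable_near_zero|exact: measurable_cell].
apply: (@le_trans _ _ (\sum_(0 <= k <oo) (c%:E * P (cell dl n k)))%E).
  apply: lee_nneseries => // k _.
  have dg := grid_ge dl n k.
  have g0 : 0 <= grid dl n k by exact: le_trans (ltW dl0) dg.
  rewrite [leLHS](indepWG _ _ (sigma_of_near_zero e _ g0) (G_cell _ _ _ dl0)).
  by rewrite lee_wpmul2r// near_zero_le.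
rewrite nneseriesZl// -[leRHS]mule1 lee_wpmul2l//.
have -> : (\sum_(0 <= k <oo) P (cell dl n k) = P (\bigcup_k cell dl n k))%E.
  rewrite measure_bigcup//; last by move=> k _; exact: measurable_cell.
  by apply: eq_eseriesl => k; rewrite in_setT.
by apply: probability_le1; apply: bigcupT_measurable => k; exact: measurable_cell.
Qed.

(** The limit inferior of the events [close e dl n] as the mesh tends to 0. *)
Let ev_close e dl : set Omega :=
  \bigcup_m \bigcap_(n in [set n | (m <= n)%N]) close e dl n.

Let measurable_tail_close e dl m : 0 < dl ->
  measurable (\bigcap_(n in [set n | (m <= n)%N]) close e dl n).
Proof.
move=> dl0; apply: bigcap_measurable; first by exists m => /=.
by move=> k _; exact: measurable_close.
Qed.

Let measurable_ev_close e dl : 0 < dl -> measurable (ev_close e dl).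
Proof.
by move=> dl0; apply: bigcupT_measurable => m; exact: measurable_tail_close.
Qed.

Let ev_close_le e dl : 0 < dl -> 0 <= e ->
  (P (ev_close e dl) <= (normal_peak (Num.sqrt dl) * (e + e))%:E)%E.
Proof.
move=> dl0 e0.
have cvP : (fun m => P (\bigcap_(n in [set n | (m <= n)%N]) close e dl n)) @ \oo
    --> P (ev_close e dl).
  apply: nondecreasing_cvg_mu.
  - by move=> m; exact: measurable_tail_close.
  - exact: measurable_ev_close.
  - move=> m n mn; apply/subsetPset => w H k /= nk; apply: H => /=.
    exact: leq_trans nk.
rewrite -(cvg_lim _ cvP)//; apply: lime_le; first by apply/cvg_ex; eexists; exact: cvP.
near=> m; apply: le_trans (close_le e dl m dl0 e0).
rewrite le_measure ?inE//; [exact: measurable_tail_close|exact: measurable_close|].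
by move=> w; apply => /=.
Unshelve. all: end_near. Qed.

Let ev_close_null dl : 0 < dl -> P (\bigcap_j ev_close j.+1%:R^-1 dl) = 0.
Proof.
move=> dl0; apply/eqP; rewrite eq_le measure_ge0 andbT.
set c := normal_peak (Num.sqrt dl).
have c0 : 0 < c by rewrite normal_peak_gt0// gt_eqF// sqrtr_gt0.
apply/lee_addgt0Pr => e e0; rewrite add0e.
(* The bound for tolerance [j.+1%:R^-1] is [c + c] times that tolerance. *)
have e1 : 0 < e / (c + c) by rewrite divr_gt0// addr_gt0.
have [j je] : exists j : nat, j.+1%:R^-1 < e / (c + c).
  have [j _ /(_ j (leqnn j))] := near_infty_natSinv_lt (PosNum e1).
  by exists j.
apply: (@le_trans _ _ (P (ev_close j.+1%:R^-1 dl))).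
  rewrite le_measure ?inE//; [|exact: measurable_ev_close|by move=> w; exact].
  by apply: bigcap_measurable => [|k _]; [exists 0%N|exact: measurable_ev_close].
have j0 : 0 <= j.+1%:R^-1 :> R by rewrite invr_ge0.
apply: le_trans (ev_close_le _ _ dl0 j0) _.
rewrite lee_fin -/c mulrDr -mulrDl mulrC -ler_pdivlMr ?ltW// addr_gt0//.
Qed.

(** Rounding moves [L w] by at most the mesh, so once the mesh is below the continuity radius [h],
    [Wt] at the rounded time is within [e] of 0. *)
Let ev_close_of_zero e dl w : {within nonneg_times, continuous (W^~ w)} ->
  0 < e -> 0 < dl -> dl < L w -> Wt w (L w) = 0 -> ev_close e dl w.
Proof.
move=> cW e0 dl0 dL WL.
have L0 : 0 <= L w by exact: ltW (lt_trans dl0 dL).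
have [h h0 H] := Wtilde_ball x0 beta cW _ _ L0 e0.
have [m _ mh] := near_infty_natSinv_lt (PosNum h0).
exists m => // n mn.
have exk : exists k, L w <= grid dl n k.
  exists (Num.trunc ((L w - dl) * n.+1%:R)).+1.
  rewrite /grid -lerBlDl ler_pdivlMr ?ltr0n//; apply: ltW; exact: truncnS_gt.
(* The least grid index at or above [L w] is not 0, since the grid starts at [dl < L w]; its
   predecessor gives the rounded time. *)
case: (ex_minnP exk) => -[|j] jL jmin.
  by move: jL; rewrite /grid mul0r addr0 leNgt dL.
have gL : grid dl n j < L w.
  by rewrite ltNge; apply/negP => /jmin; rewrite ltnn.
have Lcell : cell dl n j w by rewrite /cell/= gL jL.
exists j => //; split=> //.
have hn : n.+1%:R^-1 < h := mh n mn.
have gj : grid dl n j.+1 = grid dl n j + n.+1%:R^-1.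
  by rewrite /grid -addrA -natr1 mulrDl mul1r.
have g0 : 0 <= grid dl n j by exact: le_trans (ltW dl0) (grid_ge _ _ _).
have := H _ g0; rewrite -/(Wt w) WL subr0 => Hg.
apply/ltW/Hg; rewrite ltr_norml; move: jL gL hn; rewrite gj.
by move: (grid dl n j) (L w) (n.+1%:R^-1) => ? ? ? ? ? ?; lra.
Qed.

(** Positivity of [L] is a countable union of the events [i.+1%:R^-1 < L], and a zero on any of them
    lies in a null set. *)
Lemma indep_time_nonzero :
  {ae P, forall w, 0 < L w -> Wtilde x0 beta (W^~ w) (L w) != 0}.
Proof.
have [_ W0 _] := bmW.
have nullZ : {ae P, forall w,
    forall i, ~ (\bigcap_j ev_close j.+1%:R^-1 i.+1%:R^-1) w}.
  apply: ae_foralln => i.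
  have i0 : 0 < i.+1%:R^-1 :> R by rewrite invr_gt0.
  exists (\bigcap_j ev_close j.+1%:R^-1 i.+1%:R^-1); split.
  - by apply: bigcap_measurable => [|k _]; [exists 0%N|exact: measurable_ev_close].
  - exact: ev_close_null.
  - by move=> w /= /contrapT.
apply: filterS2 W0 nullZ => w [_ cW] notZ L0.
have [i _ /(_ i (leqnn i)) /= iL] := near_infty_natSinv_lt (PosNum L0).
apply/eqP => WL; apply: (notZ i) => j _.
by apply: ev_close_of_zero => //; rewrite invr_gt0.
Qed.

End IndependentTime.

(** * Left limits at jumps as random times, and the conclusion *)

Lemma left_sup_gt {R : realType} (tau : R -> R) (q a : R) : 0 <= a ->
  (a < left_sup tau q) <->
  exists r : rat, 0 <= r /\ a < tau (ratr r) < q.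
Proof.
move=> a0; rewrite /left_sup; set A := [set _ | _ in _].
have ubA : has_ubound A by exists q => _ [r [_ /ltW ?] <-].
split=> [aA|[r [r0 /andP[ar rq]]]].
  (* The supremum of the empty set is 0, which cannot exceed [a >= 0]. *)
  have [A0|/set0P A0] := eqVneq A set0; first by move: aA; rewrite A0 sup0 ltNge a0.
  have [_ [r [r0 rq] <-] ar] := sup_gt A0 aA.
  by exists r; rewrite ar.
by apply: lt_le_trans ar _; apply: (ub_le_sup ubA); exists r.
Qed.

Lemma sigma_of_left_sup {R : realType} {d} {Omega : measurableType d}
    (T : R -> Omega -> R) (q a b : R) : 0 <= a -> a <= b ->
  sigma_of T nonneg_times [set w | a < left_sup (T^~ w) q <= b].
Proof.
move=> a0 ab.
set G := \bigcup_(i in nonneg_times) preimage_set_system setT (T i) measurable.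
(* In this type, measurable means belonging to the sigma-algebra generated by [T]. *)
pose OG := g_sigma_algebraType G.
have mgt c : 0 <= c -> measurable ([set w | c < left_sup (T^~ w) q] : set OG).
  move=> c0.
  rewrite (_ : [set _ | _] =
    \bigcup_(r : rat) [set w | 0 <= r /\ c < T (ratr r) w < q]).
    apply: bigcupT_measurable_rat => r.
    have [r0|r0] := leP 0 r; last first.
      by rewrite (_ : [set _ | _] = set0)// -subset0 => w [].
    rewrite (_ : [set _ | _] = T (ratr r) @^-1` `]c, q[%classic).
      apply: sub_sigma_algebra; exists (ratr r); first by rewrite /nonneg_times/= ler0q.
      by exists `]c, q[%classic => //; rewrite setTI.
    by apply/seteqP; split => w /=; rewrite in_itv/=; [case|].
  apply/seteqP; split => w /=.
    by move=> /(left_sup_gt _ _ _ c0)[r [r0 rq]]; exists r.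
  by move=> [r _ [r0 rq]]; apply/left_sup_gt => //; exists r.
rewrite (_ : [set _ | _] =
    [set w | a < left_sup (T^~ w) q] `\` [set w | b < left_sup (T^~ w) q]).
  exact: (measurableD (mgt _ a0) (mgt _ (le_trans a0 ab))).
apply/seteqP; split => w /=.
  by move=> /andP[? ?]; split => //; apply/negP; rewrite -leNgt.
by move=> [-> /negP]; rewrite -leNgt.
Qed.

Theorem theorem4p2 (R : realType) (d : measure_display) (Omega : measurableType d)
    (P : probability Omega R) (W T : R -> Omega -> R) (beta x0 : R) :
  is_brownian_motion P W ->
  is_subordinator P T ->
  indep_sys P (sigma_of W nonneg_times) (sigma_of T nonneg_times) ->
  0 < x0 ->
  {ae P, forall w,
    (fun i : nat => tstar x0 beta (W^~ w) (T^~ w) i.+1) @ \oo -->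
      first_passage x0 beta (W^~ w) (T^~ w)}.
Proof.
move=> bmW subT indepWT x00.
have [_ W0 _] := bmW; have [mT T0 _] := subT.
(* Enumerating the rationals through [unpickle] merges the exceptional sets of all [q] into one null
   set. *)
have nz : {ae P, forall w, forall n, forall q, unpickle n = Some q ->
    0 < left_sup (T^~ w) (ratr q) ->
    Wtilde x0 beta (W^~ w) (left_sup (T^~ w) (ratr (q : rat))) != 0}.
  apply: ae_foralln => n; case: unpickle => [q|]; last exact: aeW.
  apply: filterS (indep_time_nonzero P W x0 beta bmW _
    (fun w => left_sup (T^~ w) (ratr q)) indepWT _ _).
  - by move=> w H _ [<-].
  - exact: sigma_of_measurable.
  - by move=> a b; exact: sigma_of_left_sup.
apply: filterS3 W0 T0 nz => w [w0 cW] [t0 mono rc] nz.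
apply: tstar_cvg => // q; exact: (nz (pickle q) q (pickleK q)).
Qed.
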